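(* Let the single birth $Q$-matrix $Q=(q_{ij})$ on $\mathbb Z_+$ be non-explosive and irreducible. Then the return/extinction probabilities of the corresponding process are $$\mathbb P_0(\sigma_0<\infty)=\frac{\sum_{k=1}^\infty F_k^{(0)}}{\sum_{k=0}^\infty F_k^{(0)}},\qquad \mathbb P_n(\sigma_0<\infty)=\frac{\sum_{k=n}^\infty F_k^{(0)}}{\sum_{k=0}^\infty F_k^{(0)}},\qquad n\ge 1,$$ where, when $\sum_{k=0}^\infty F_k^{(0)}=\infty$, the ratios are understood to be equal to $1$. Furthermore, $\mathbb P_n(\sigma_0<\infty)=1$ for all $n\ge 0$ if and only if $\mathbb P_0(\sigma_0<\infty)=1$, equivalently if and only if $\sum_{n=0}^\infty F_n^{(0)}=\infty$.
   Context: A single birth $Q$-matrix on $\mathbb Z_+=\{0,1,2,\dots\}$ is a real matrix $Q=(q_{ij})$ with $q_{ij}\ge 0$ for $i\neq j$, which is conservative ($\sum_j q_{ij}=0$ for every $i$), irreducible, and satisfies $q_{i,i+1}>0$ and $q_{i,i+j}=0$ for all $i\in\mathbb Z_+$ and $j\ge 2$. It is non-explosive if the corresponding continuous-time Markov chain $X(t)$ has a.s. only finitely many jumps in finite time (equivalently the $Q$-process is unique). $\mathbb P_n$ is the law of the chain started at $n$, and $\sigma_0=\inf\{t\ge\eta_1:X(t)=0\}$, where $\eta_1$ is the first jump time. Define $q_n^{(k)}=\sum_{j=0}^kq_{nj}$ for $0\le k<n$, and $$F_i^{(i)}=1,\qquad F_n^{(i)}=\frac1{q_{n,n+1}}\sum_{k=i}^{n-1}q_n^{(k)}F_k^{(i)},\qquad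 n>i\ge 0.$$ *)

(* Defs.v *)
From HB Require Import structures.
From mathcomp Require Import all_boot all_order all_algebra.
From mathcomp Require Import all_classical all_reals all_analysis.

Set Implicit Arguments.
Unset Strict Implicit.
Unset Printing Implicit Defensive.

Import Order.TTheory GRing.Theory Num.Theory.
Import numFieldNormedType.Exports.

Local Open Scope classical_set_scope.
Local Open Scope ring_scope.

Section QMatrix.
Context {R : realType}.
Implicit Types (Q : nat -> nat -> R).

Definition conservative Q :=
  forall i, series (fun j => Q i j) @ \oo --> (0 : R).

Definition irreducible Q :=
  forall i j, exists2 p : seq nat,
    path (fun a b => 0 < Q a b) i p & last i p = j.

Record single_birth Q : Prop := SingleBirth {
  offdiag_ge0 : forall i j, i != j -> 0 <= Q i j;
  single_birth_conservative : conservative Q;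
  single_birth_irreducible : irreducible Q;
  birth_gt0 : forall i, 0 < Q i i.+1;
  birth_single : forall i j, (2 <= j)%N -> Q i (i + j)%N = 0 }.

Definition exit_rate Q i : R := - Q i i.

(* The formula presupposes [exit_rate Q i != 0]; a single birth Q-matrix has
   no absorbing state, since [exit_rate Q i >= Q i i.+1 > 0]. *)
Definition jump_matrix Q i j : R :=
  if i == j then 0 else Q i j / exit_rate Q i.

(* [qsum Q n k] is q_n^{(k)}. *)
Definition qsum Q (n k : nat) : R := \sum_(j < k.+1) Q n j.

(* [Ftable Q i m] is the sequence F_i^{(i)}, ..., F_{i+m}^{(i)}. *)
Fixpoint Ftable Q (i m : nat) : seq R :=
  if m is m'.+1 then
    let s := Ftable Q i m' in
    rcons s ((Q (i + m)%N (i + m).+1)^-1 *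
             \sum_(k < m) qsum Q (i + m) (i + k) * s`_k)
  else [:: 1].

(* [Fcoef Q i n] is F_n^{(i)}, meaningful for [i <= n] only; the lemmas
   [Fcoef_diag] and [Fcoef_rec] are its defining equations. *)
Definition Fcoef Q (i n : nat) : R := (Ftable Q i (n - i))`_(n - i).

Lemma size_Ftable Q i m : size (Ftable Q i m) = m.+1.
Proof. by elim: m => //= m IH; rewrite size_rcons IH. Qed.

Lemma nth_Ftable Q i m k : (k <= m)%N -> (Ftable Q i m)`_k = (Ftable Q i k)`_k.
Proof.
elim: m => [|m IH]; first by rewrite leqn0 => /eqP ->.
rewrite leq_eqVlt => /predU1P[->//|km].
by rewrite /= nth_rcons size_Ftable km IH.
Qed.

Lemma Fcoef_diag Q i : Fcoef Q i i = 1.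
Proof. by rewrite /Fcoef subnn. Qed.

Lemma Fcoef_rec Q i n : (i < n)%N ->
  Fcoef Q i n = (Q n n.+1)^-1 * \sum_(i <= k < n) qsum Q n k * Fcoef Q i k.
Proof.
move=> lt_in; rewrite /Fcoef.
have [m defn] : exists m, n = (i + m.+1)%N.
  by exists (n - i).-1; rewrite prednK ?subn_gt0// subnKC// ltnW.
rewrite {}defn addKn /= nth_rcons size_Ftable ltnn eqxx; congr (_ * _).
have -> : index_iota i (i + m.+1) = index_iota (0 + i) (i + m.+1) by []; rewrite big_addn addKn big_mkord; apply: eq_bigr => k _.
by rewrite addnK [(k + i)%N]addnC nth_Ftable // -ltnS.
Qed.

(* [Ftail Q n] is \sum_(k >= n) F_k^{(0)}, possibly +oo. *)
Definition Ftail Q (n : nat) : \bar R :=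
  (\sum_(n <= k <oo) (Fcoef Q 0 k)%:E)%E.

Definition Fratio Q (n : nat) : R :=
  if Ftail Q 0 == +oo%E then 1 else fine (Ftail Q n) / fine (Ftail Q 0).

End QMatrix.

(* A path is a function of time (only times >= 0 matter) with values in
   [option nat], where [None] is the cemetery reached at explosion. *)
Section Path.
Context {R : realType}.
Implicit Types (x : R -> option nat) (m : nat).

Fixpoint jump_time x m : \bar R :=
  if m is m'.+1 then
    if jump_time x m' is r%:E%E then
      ereal_inf [set t%:E%E | t in [set t : R | r <= t /\ x t <> x r]]
    else +oo%E
  else 0%:E%E.

Definition holding_time x m : \bar R :=
  if jump_time x m is r%:E%E then (jump_time x m.+1 - r%:E)%E else +oo%E.

Definition jump_chain x m : option nat :=
  if jump_time x m is r%:E%E then x r else None.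

Definition explosion_time x : \bar R := ereal_sup (range (jump_time x)).

Definition sigma0 x : \bar R :=
  ereal_inf [set t%:E%E | t in
    [set t : R | (jump_time x 1 <= t%:E)%E /\ x t = Some 0%N]].

End Path.

Section Chain.
Context {R : realType} {d : measure_display} {T : measurableType d}.
Implicit Types (Q : nat -> nat -> R) (P : nat -> probability T R).
Implicit Types (X : R -> T -> option nat).

Definition jump_chain_event X (m : nat) (i : nat -> nat) : set T :=
  [set w | forall k, (k <= m)%N -> jump_chain (X^~ w) k = Some (i k)].

Definition holding_event X (m : nat) (t : nat -> R) : set T :=
  [set w | forall k, (k <= m)%N -> ((t k)%:E < holding_time (X^~ w) k)%E].

(* The minimal right-continuous continuous-time Markov chain with Q-matrix Q:
   under [P n], the jump chain is a discrete-time Markov chain started at n with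
   transition matrix [jump_matrix Q] and, conditionally on the states
   i_0, ..., i_m visited, the successive holding times are independent and
   exponential with rates [exit_rate Q i_k]. *)
Record markov_chain Q P X : Prop := MarkovChain {
  chain_measurable : forall t, 0 <= t ->
    forall i, measurable [set w | X t w = i];
  chain_right_continuous : forall w t, 0 <= t ->
    \forall s \near t^'+, X s w = X t w;
  chain_minimal : forall w t,
    (explosion_time (X^~ w) <= t%:E)%E -> X t w = None;
  chain_jump_law : forall n m (i : nat -> nat),
    P n (jump_chain_event X m i) =
    ((i 0%N == n)%:R * \prod_(k < m) jump_matrix Q (i k) (i k.+1))%:E%E;
  chain_holding_law : forall n m (i : nat -> nat) (t : nat -> R),
    (forall k, 0 <= t k) ->
    P n (jump_chain_event X m i `&` holding_event X m t) =
    (P n (jump_chain_event X m i) *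
     (\prod_(k < m.+1) expR (- exit_rate Q (i k) * t k))%:E)%E }.

Definition nonexplosive P X :=
  forall n, {ae P n, forall w, forall t : R,
    finite_set [set m | (jump_time (X^~ w) m <= t%:E)%E]}.

Definition return_prob P X (n : nat) : \bar R :=
  P n [set w | (sigma0 (X^~ w) < +oo)%E].

End Chain.

(* Main.v *)
Require Import Defs.
From mathcomp Require Import all_boot all_order all_algebra.
From mathcomp Require Import all_classical all_reals all_analysis.
From mathcomp Require Import ring.

(* The process returns to 0 iff its jump chain visits 0 at some positive index,
   so by first-step analysis the return probabilities h form the least
   nonnegative solution of h n = \sum_j p n j * h' j, where p is the jump matrix
   and h' is h with h' 0 = 1.  Since the births are single, summation by parts
   turns these equations into the recursion of F_n^{(0)} for the increments
   h' n - h' n.+1, hence h' n = 1 - (1 - h 1) * \sum_(k < n) F_k^{(0)}, and the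
   least nonnegative solution is the one with 1 - h 1 = (\sum_k F_k^{(0)})^-1,
   read as 0 when the series diverges. *)

Set Implicit Arguments.
Unset Strict Implicit.
Unset Printing Implicit Defensive.

Import Order.TTheory GRing.Theory Num.Theory.
Import numFieldNormedType.Exports.

Local Open Scope classical_set_scope.
Local Open Scope ring_scope.

Section Algebra.
Context {R : realType}.
Implicit Types (Q : nat -> nat -> R) (f g h : nat -> R).

(** * Row sums, signs and the jump matrix of a single birth Q-matrix *)

Lemma summation_by_parts (a f : nat -> R) m :
  \sum_(j < m.+1) a j * f j =
  \sum_(k < m) (\sum_(j < k.+1) a j) * (f k - f k.+1) +
  (\sum_(j < m.+1) a j) * f m.
Proof.
elim: m => [|m IH]; first by rewrite big_ord0 !big_ord1 add0r.
rewrite big_ord_recr /= IH [in RHS]big_ord_recr /= [\sum_(j < m.+2) _]big_ord_recr /=.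
ring.
Qed.

(** Row [n] vanishes beyond column [n.+1], so the partial sums of the conservative series are
    eventually constant and equal to this finite sum. *)
Lemma single_birth_row_sum Q n : single_birth Q -> \sum_(j < n.+2) Q n j = 0.
Proof.
move=> hQ; apply: (@cvg_unique _ (@norm_hausdorff _ R^o)
    (series (fun j => Q n j) @ \oo) _ _ _ _ (single_birth_conservative hQ n)).
apply: cvg_near_cst; near=> m.
have hm : (n.+2 <= m)%N by near: m; exact: nbhs_infty_ge.
rewrite /series /= (big_cat_nat (leq0n _) hm) /= big_mkord.
rewrite [X in _ + X]big_nat_cond [X in _ + X]big1 ?addr0// => j /andP[/andP[hj _] _].
have -> : j = (n + (j - n))%N by rewrite subnKC// ltnW// ltnW.
by apply: (birth_single hQ); rewrite leq_subRL ?addn2// ltnW// ltnW.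
Unshelve. all: by end_near. Qed.

Lemma qsum_ge0 Q n k : single_birth Q -> (k < n)%N -> 0 <= qsum Q n k.
Proof.
move=> hQ kn; apply: sumr_ge0 => j _; apply: (offdiag_ge0 hQ).
by rewrite neq_ltn (leq_trans (ltn_ord j) kn) orbT.
Qed.

Lemma Fcoef_ge0 Q i n : single_birth Q -> (i <= n)%N -> 0 <= Fcoef Q i n.
Proof.
move=> hQ; elim/ltn_ind: n => n IH; rewrite leq_eqVlt => /predU1P[<-|lt_in].
  by rewrite Fcoef_diag.
rewrite Fcoef_rec// mulr_ge0 ?invr_ge0//; first exact/ltW/birth_gt0.
rewrite big_nat_cond; apply: sumr_ge0 => k /andP[/andP[ik kn] _].
by rewrite mulr_ge0 ?qsum_ge0 ?IH.
Qed.

Lemma exit_rate_gt0 Q n : single_birth Q -> 0 < exit_rate Q n.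
Proof.
move=> hQ; have := single_birth_row_sum n hQ.
rewrite 2!big_ord_recr /= => /eqP; rewrite -addrA addrCA addr_eq0 => /eqP.
rewrite /exit_rate => ->; rewrite opprK; apply: ltr_wpDl (birth_gt0 hQ n).
apply: sumr_ge0 => j _; apply: (offdiag_ge0 hQ).
by rewrite neq_ltn ltn_ord orbT.
Qed.

Lemma jump_matrix_ge0 Q i j : single_birth Q -> 0 <= jump_matrix Q i j.
Proof.
move=> hQ; rewrite /jump_matrix; case: eqP => // /eqP ij.
by rewrite mulr_ge0 ?(offdiag_ge0 hQ)// invr_ge0 ltW// exit_rate_gt0.
Qed.

(** The jump matrix is the identity plus the row of [Q] divided by the exit rate: the diagonal term
    of [Q] contributes [- f n], which cancels the added [f n]. *)
Lemma jump_matrix_mean Q f n : single_birth Q ->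
  \sum_(j < n.+2) jump_matrix Q n j * f j =
  f n + (exit_rate Q n)^-1 * \sum_(j < n.+2) Q n j * f j.
Proof.
move=> hQ; have e0 := lt0r_neq0 (exit_rate_gt0 n hQ).
have nn2 : (n < n.+2)%N by rewrite ltnW.
rewrite (bigD1 (Ordinal nn2))//= [in RHS](bigD1 (Ordinal nn2))//=.
rewrite {1}/jump_matrix eqxx mul0r add0r.
have -> : Q n n = - exit_rate Q n by rewrite opprK.
rewrite mulrDr mulrA mulrN mulVf// mulN1r addrA subrr add0r mulr_sumr.
apply: eq_bigr => j; rewrite -val_eqE /= => jn.
by rewrite /jump_matrix eq_sym (negbTE jn) mulrAC mulrC mulrA mulrAC.
Qed.

Lemma jump_matrix_row_sum Q n : single_birth Q ->
  \sum_(j < n.+2) jump_matrix Q n j = 1.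
Proof.
move=> hQ; have := jump_matrix_mean (fun=> 1) n hQ.
by rewrite -mulr_suml mulr1 => ->;
  rewrite -mulr_suml single_birth_row_sum// mul0r mulr0 addr0.
Qed.

(** Summation by parts: the boundary term carries the full row sum, which is 0, and the last partial
    sum, up to column [n], is therefore [- Q n n.+1]. *)
Lemma Q_mean_increments Q f n : single_birth Q ->
  \sum_(j < n.+2) Q n j * f j =
  \sum_(k < n) qsum Q n k * (f k - f k.+1) - Q n n.+1 * (f n - f n.+1).
Proof.
move=> hQ; rewrite summation_by_parts single_birth_row_sum// mul0r addr0.
rewrite big_ord_recr /=; congr (_ + _).
have := single_birth_row_sum n hQ; rewrite big_ord_recr /= => /eqP.
by rewrite addr_eq0 => /eqP ->; rewrite mulNr.
Qed.

(** * First-step equations as a recursion for increments *)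

(* Returning to 0 counts from the first jump on, so state 0 contributes 1 to a
   first-step average even though the return probability from 0 may be less. *)
Definition set1_at0 f (j : nat) : R := if j == 0%N then 1 else f j.

Definition return_step Q f (n : nat) : R :=
  \sum_(j < n.+2) jump_matrix Q n j * set1_at0 f j.

(** The first jump from 0 leads to 1 with probability one. *)
Lemma return_step0 Q f : single_birth Q -> return_step Q f 0 = f 1%N.
Proof.
move=> hQ; have := jump_matrix_row_sum 0 hQ.
rewrite /return_step !big_ord_recr !big_ord0 /= {1 3}/jump_matrix eqxx.
by rewrite mul0r !add0r => ->; rewrite mul1r.
Qed.

(** Once [f n] cancels, the equation says that row [n] of [Q] annihilates [set1_at0 f]; written in
    increments it can be solved for the last one, since [Q n n.+1] is positive. *)
Lemma return_step_increments Q f n : single_birth Q -> (0 < n)%N ->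
  return_step Q f n = f n <->
  set1_at0 f n - set1_at0 f n.+1 =
  (Q n n.+1)^-1 * \sum_(k < n) qsum Q n k * (set1_at0 f k - set1_at0 f k.+1).
Proof.
move=> hQ n0; have b0 := lt0r_neq0 (birth_gt0 hQ n).
have e0 := lt0r_neq0 (exit_rate_gt0 n hQ).
rewrite /return_step jump_matrix_mean// Q_mean_increments//.
have -> : f n = set1_at0 f n by rewrite /set1_at0 gtn_eqF.
set S := \sum_(k < n) _; set D := set1_at0 f n - _.
split=> [/eqP|->]; last by rewrite mulrA divff// mul1r subrr mulr0 addr0.
rewrite -subr_eq0 addrAC subrr add0r mulf_eq0 invr_eq0 (negbTE e0)/= subr_eq0.
by move=> /eqP ->; rewrite mulrA mulVf// mul1r.
Qed.

(** The recursion is linear and determined by its value at 0, and F^{(0)} is its solution with value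
    1 there. *)
Lemma increments_Fcoef Q (D : nat -> R) : single_birth Q ->
  (forall n, (0 < n)%N -> D n = (Q n n.+1)^-1 * \sum_(k < n) qsum Q n k * D k) ->
  forall n, D n = D 0%N * Fcoef Q 0 n.
Proof.
move=> hQ HD; elim/ltn_ind => -[|n] IH; first by rewrite Fcoef_diag mulr1.
rewrite HD// Fcoef_rec// mulrCA big_mkord; congr (_ * _).
by rewrite mulr_sumr; apply: eq_bigr => k _; rewrite IH// mulrCA.
Qed.

(** * Sums of F^{(0)} and the least nonnegative solution *)

Definition Fsum Q (n : nat) : R := \sum_(k < n) Fcoef Q 0 k.

(** The increments telescope from the value 1 at state 0, and the first of them is [1 - h 1]. *)
Lemma return_step_fixed Q h : single_birth Q ->
  (forall n, (0 < n)%N -> return_step Q h n = h n) ->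
  forall n, set1_at0 h n = 1 - (1 - h 1%N) * Fsum Q n.
Proof.
move=> hQ hh n.
have HD := increments_Fcoef (D := fun n => set1_at0 h n - set1_at0 h n.+1) hQ
  (fun n n0 => (return_step_increments h hQ n0).1 (hh n n0)).
elim: n => [|n IH]; first by rewrite /Fsum big_ord0 mulr0 subr0.
by rewrite /Fsum big_ord_recr /= mulrDr opprD addrA -IH -HD; ring.
Qed.

Lemma Ftail_ge0 Q n : single_birth Q -> (0 <= Ftail Q n)%E.
Proof. by move=> hQ; apply: nneseries_ge0 => k _ _; rewrite lee_fin Fcoef_ge0. Qed.

Lemma Ftail0_split Q n : single_birth Q ->
  Ftail Q 0 = ((Fsum Q n)%:E + Ftail Q n)%E.
Proof.
move=> hQ; rewrite /Ftail (nneseries_split 0 n) ?add0n; last first.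
  by move=> k _; rewrite lee_fin Fcoef_ge0.
by rewrite sumEFin big_mkord.
Qed.

Lemma Ftail0_le Q c : single_birth Q ->
  (forall n, Fsum Q n <= c) -> (Ftail Q 0 <= c%:E)%E.
Proof.
move=> hQ Hc; apply: lime_le.
  by apply: is_cvg_nneseries => k _ _; rewrite lee_fin Fcoef_ge0.
by apply: nearW => n; rewrite sumEFin lee_fin big_mkord; exact: Hc.
Qed.

Lemma Ftail_fine Q n : single_birth Q -> Ftail Q 0 != +oo%E ->
  fine (Ftail Q n) = fine (Ftail Q 0) - Fsum Q n.
Proof.
move=> hQ; rewrite (Ftail0_split n hQ); have := Ftail_ge0 n hQ.
by case: (Ftail Q n) => [r| |]//= _ _; rewrite addrAC subrr add0r.
Qed.

Lemma Fsum1 Q : Fsum Q 1 = 1.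
Proof. by rewrite /Fsum big_ord1 Fcoef_diag. Qed.

Lemma Ftail0_fine_gt0 Q : single_birth Q -> Ftail Q 0 != +oo%E ->
  0 < fine (Ftail Q 0).
Proof.
move=> hQ; rewrite (Ftail0_split 1 hQ) Fsum1; have := Ftail_ge0 1 hQ.
case: (Ftail Q 1) => [r| |]//=; rewrite lee_fin => r0 _.
exact: ltr_pwDl.
Qed.

Lemma FratioE Q n : single_birth Q -> Ftail Q 0 != +oo%E ->
  Fratio Q n = 1 - (fine (Ftail Q 0))^-1 * Fsum Q n.
Proof.
move=> hQ Fy; rewrite /Fratio (negbTE Fy) (Ftail_fine n)// mulrBl divff.
  by rewrite [X in _ - X]mulrC.
exact/lt0r_neq0/Ftail0_fine_gt0.
Qed.

(** The increments of the ratio are multiples of F^{(0)}, so they satisfy the recursion. The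
    [maxn 1] gives state 0 the value of state 1, where its first jump leads. *)
Lemma Fratio_step Q n : single_birth Q -> Ftail Q 0 != +oo%E ->
  return_step Q (fun m => Fratio Q (maxn 1 m)) n = Fratio Q (maxn 1 n).
Proof.
move=> hQ Fy; set g := fun m => Fratio Q (maxn 1 m).
have [->|n0] := posnP n; first by rewrite return_step0.
have gE m : set1_at0 g m = 1 - (fine (Ftail Q 0))^-1 * Fsum Q m.
  rewrite /set1_at0 /g; case: m => [|m] /=.
    by rewrite /Fsum big_ord0 mulr0 subr0.
  by rewrite (maxn_idPr _)// FratioE.
have gD m : set1_at0 g m - set1_at0 g m.+1 =
    (fine (Ftail Q 0))^-1 * Fcoef Q 0 m.
  by rewrite !gE /Fsum big_ord_recr /=; ring.
apply/(return_step_increments g hQ n0); rewrite gD Fcoef_rec// mulrCA big_mkord.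
congr (_ * _); rewrite mulr_sumr; apply: eq_bigr => k _.
by rewrite gD mulrCA.
Qed.

(* Nonnegativity of h bounds the increment 1 - h 1 above by the inverse of the
   total sum; comparison with the fixed point of [Fratio_step] bounds it below. *)
Lemma Fratio_minimal Q h : single_birth Q ->
  (forall n, 0 <= h n <= 1) ->
  (forall n, return_step Q h n = h n) ->
  (forall g, (forall n, 0 <= g n) -> (forall n, return_step Q g n = g n) ->
    forall n, h n <= g n) ->
  forall n, h n = Fratio Q (maxn 1 n).
Proof.
move=> hQ h01 hh hmin.
have hE := return_step_fixed hQ (fun n _ => hh n).
(* The equation at state 0 reads h 0 = h 1, which leaves only the positive states. *)
have h_maxn n : h n = h (maxn 1 n).
  by case: n => [|n]; [rewrite -{1}hh return_step0|rewrite (maxn_idPr _)].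
suff H n : (0 < n)%N -> h n = Fratio Q n.
  by move=> n; rewrite h_maxn H// leq_max.
move=> n0; have -> : h n = set1_at0 h n by rewrite /set1_at0 gtn_eqF.
have hge0 m : 0 <= set1_at0 h m.
  by rewrite /set1_at0; case: eqP => // _; have /andP[] := h01 m.
have D0 : 0 <= 1 - h 1%N by rewrite subr_ge0; have /andP[] := h01 1%N.
have FD : 1 - h 1%N != 0 -> (Ftail Q 0 <= (1 - h 1%N)^-1%:E)%E.
  move=> D1; apply: Ftail0_le => // m; rewrite -[leRHS]mul1r ler_pdivlMr.
    by rewrite mulrC; have := hge0 m; rewrite hE subr_ge0.
  by rewrite lt_neqAle eq_sym D1.
rewrite hE; have [Fy|Fy] := eqVneq (Ftail Q 0) +oo%E.
  (* When the series diverges, a nonzero [1 - h 1] would bound its sum by [FD]; hence the increment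
     is 0. *)
  rewrite /Fratio Fy eqxx.
  have [->|/FD] := eqVneq (1 - h 1%N) 0; first by rewrite mul0r subr0.
  by rewrite Fy.
have S0 := Ftail0_fine_gt0 hQ Fy.
rewrite FratioE//; congr (1 - _ * _); apply/eqP; rewrite eq_le; apply/andP; split.
- have [->|D1] := eqVneq (1 - h 1%N) 0; first by rewrite invr_ge0 ltW.
  rewrite -[leLHS]invrK lef_pV2 ?posrE ?invr_gt0//; last first.
    by rewrite lt_neqAle eq_sym D1.
  rewrite -lee_fin fineK ?FD// ge0_fin_numE ?Ftail_ge0// ltey.
  by [].
- have := hmin _ (fun m => _) (fun m => Fratio_step m hQ Fy) 1%N.
  rewrite maxnn FratioE// Fsum1 mulr1 lerBrDr -lerBrDl; apply.
  move=> m; rewrite /Fratio (negbTE Fy) divr_ge0 ?fine_ge0 ?Ftail_ge0//.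
Qed.

(** If the series converges, the ratio falls short of 1 by the inverse of its sum. *)
Lemma Fratio1_eq1 Q : single_birth Q -> Fratio Q 1 = 1 <-> Ftail Q 0 = +oo%E.
Proof.
move=> hQ; split=> [|Fy]; last by rewrite /Fratio Fy eqxx.
have [//|Fy] := eqVneq (Ftail Q 0) +oo%E.
rewrite FratioE// Fsum1 mulr1 => /eqP; rewrite -subr_eq0 addrAC subrr add0r.
by rewrite oppr_eq0 invr_eq0 gt_eqF ?Ftail0_fine_gt0.
Qed.
End Algebra.

(** * Jump times of a path, and their description by rational times *)

Section Paths.
Context {R : realType}.
Implicit Types (x : R -> option nat) (m : nat) (r s t : R).

Lemma jump_time_ge0 x m : (0 <= jump_time x m)%E.
Proof.
elim: m => [//|m]; rewrite /=; case: (jump_time x m) => [r| |]//.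
rewrite lee_fin => r0; apply: le_ereal_inf_tmp => _ [t [rt _] <-].
by rewrite lee_fin (le_trans r0).
Qed.

Lemma jump_time_leS x m : (jump_time x m <= jump_time x m.+1)%E.
Proof.
rewrite /=; case: (jump_time x m) => [r| |]//=.
by apply: le_ereal_inf_tmp => _ [t [rt _] <-]; rewrite lee_fin.
Qed.

Lemma jump_time_homo x : {homo jump_time x : m n / (m <= n)%N >-> (m <= n)%E}.
Proof. by apply: homo_leq => //; [exact: le_trans|exact: jump_time_leS]. Qed.

Lemma jump_time_fin x m (y : \bar R) : (jump_time x m < y)%E ->
  exists2 r, jump_time x m = r%:E & 0 <= r.
Proof.
have := jump_time_ge0 x m; case: (jump_time x m) => [r| |]//.
- by rewrite lee_fin => r0 _; exists r.
- by move=> _; rewrite ltNge leey.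
Qed.

Lemma jump_timeS_le x m r s : jump_time x m = r%:E -> r <= s -> x s <> x r ->
  (jump_time x m.+1 <= s%:E)%E.
Proof. by move=> /= -> rs xs; apply: ereal_inf_lbound; exists s. Qed.

Lemma constant_between_jumps x m r s : jump_time x m = r%:E -> r <= s ->
  (s%:E < jump_time x m.+1)%E -> x s = x r.
Proof.
move=> Jr rs; rewrite ltNge => /negP sJ; apply: contrapT => xs; apply: sJ.
exact: jump_timeS_le Jr rs xs.
Qed.

(** A time spent at 0 precedes the explosion, hence lies between two consecutive jump times, and the
    path is constant there. Conversely, a jump time at which 0 is entered is itself such a time. *)
Lemma sigma0_fin x : (forall t, (explosion_time x <= t%:E)%E -> x t = None) ->
  (sigma0 x < +oo)%E <-> exists2 m, (0 < m)%N & jump_chain x m = Some 0%N.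
Proof.
move=> xmin; split=> [/ereal_inf_lt[_ [t [J1t xt] <-] _]|[m m0]]; last first.
  rewrite /jump_chain; case Jm : (jump_time x m) => [r| |]// xr.
  apply: (@le_lt_trans _ _ r%:E); last exact: ltry.
  apply: ereal_inf_lbound; exists r => //; split=> //.
  by rewrite -Jm; exact: jump_time_homo.
have : (t%:E < explosion_time x)%E.
  by rewrite ltNge; apply/negP => /xmin; rewrite xt.
case/ereal_sup_gt => _ [m _ <-] tJm.
have exJ : exists m, (t%:E < jump_time x m)%E by exists m.
(* The least jump index whose time exceeds [t] is neither 0 nor 1, because [t] is at least the first
   jump time; its predecessor [k] is the positive index sought. *)
case: (ex_minnP exJ) => {tJm} -[|k] tJ Jmin.
  by move: (lt_le_trans tJ (le_trans (jump_time_leS x 0) J1t)); rewrite ltxx.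
have k0 : (0 < k)%N.
  by case: k tJ Jmin => // tJ _; move: (lt_le_trans tJ J1t); rewrite ltxx.
have Jkt : (jump_time x k <= t%:E)%E.
  by rewrite leNgt; apply/negP => /Jmin; rewrite ltnn.
have [r Jk _] := jump_time_fin (le_lt_trans Jkt (ltry t)).
exists k => //; rewrite /jump_chain Jk -xt; symmetry.
by apply: (constant_between_jumps Jk _ tJ); rewrite -lee_fin -Jk.
Qed.

Lemma right_constant x t : (\forall s \near t^'+, x s = x t) ->
  exists2 e, 0 < e & forall s, t < s < t + e -> x s = x t.
Proof.
move/nbhs_ballP => [e /= e0 He]; exists e => // s /andP[ts se].
apply: He => //=; rewrite /ball/= distrC gtr0_norm ?subr_gt0//.
by rewrite ltrBlDl.
Qed.

Section RightContinuous.
Context (x : R -> option nat).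
Context (xrc : forall t, 0 <= t -> \forall s \near t^'+, x s = x t).

(* The rational points just after a jump determine the state entered. *)
Lemma jump_state_rat m v : (exists2 r, jump_time x m = r%:E & x r = v) <->
  exists2 q : rat, (jump_time x m < (ratr q)%:E)%E &
    forall q' : rat, q' <= q -> (jump_time x m < (ratr q')%:E)%E ->
      x (ratr q') = v.
Proof.
split=> [[r Jr xr]|[q Jq Hq]].
  have r0 : 0 <= r by have := jump_time_ge0 x m; rewrite Jr.
  have [e e0 He] := right_constant (xrc r0).
  have [q] := @rat_in_itvoo R r (r + e) ltac:(by rewrite ltrDl).
  rewrite in_itv /= => /andP[rq qe]; exists q; first by rewrite Jr lte_fin.
  move=> q' qq; rewrite Jr lte_fin => rq'; rewrite -xr; apply: He.
  by rewrite rq' (le_lt_trans _ qe)// ler_rat.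
have [r Jr r0] := jump_time_fin Jq; exists r => //.
have [e e0 He] := right_constant (xrc r0).
move: Jq Hq; rewrite Jr lte_fin => rq Hq.
(* At such a [q'] the path has the value [v] by the choice of [q], and still the value [x r] by
   right continuity. *)
have [q'] := @rat_in_itvoo R r (Num.min (ratr q) (r + e))
  ltac:(by rewrite lt_min rq ltrDl).
rewrite in_itv /= lt_min => /and3P[rq' qq' qe].
by rewrite -(Hq q') ?lte_fin//; [rewrite He ?rq'|rewrite -(ler_rat R) ltW].
Qed.

(** This replaces an uncountable infimum by countably many conditions: if the path has left its
    state at some time before [t], right continuity keeps it in the new state up to a later rational
    time still before [t]. *)
Lemma jump_timeS_lt m t : (jump_time x m.+1 < t%:E)%E <->
  exists (q : rat) (v : option nat), [/\ ratr q < t,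
    (jump_time x m < (ratr q)%:E)%E,
    (exists2 r, jump_time x m = r%:E & x r = v) & x (ratr q) <> v].
Proof.
split=> [Jt|[q [v [qt Jq [r Jr <-] xq]]]]; last first.
  apply: (@le_lt_trans _ _ (ratr q)%:E); last by rewrite lte_fin.
  apply: (jump_timeS_le Jr) => //.
  by move: Jq; rewrite Jr lte_fin => /ltW.
have [r Jr r0] := jump_time_fin (le_lt_trans (jump_time_leS x m) Jt).
move: Jt; rewrite /= Jr => /ereal_inf_lt[_ [s [rs xs] <-]]; rewrite lte_fin => st.
have [e e0 He] := right_constant (xrc (le_trans r0 rs)).
have [q] := @rat_in_itvoo R s (Num.min t (s + e))
  ltac:(by rewrite lt_min st ltrDl).
rewrite in_itv /= lt_min => /and3P[sq qt qe].
exists q, (x r); split=> //; first by rewrite lte_fin (le_lt_trans rs).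
  by exists r.
by rewrite He ?sq.
Qed.
End RightContinuous.
End Paths.

(** * Measurability of the jump times and of the jump chain *)

Section JumpChain.
Context {R : realType} {d : measure_display} {T : measurableType d}.
Context (Q : nat -> nat -> R) (P : nat -> probability T R).
Context (X : R -> T -> option nat).
Context (hX : markov_chain Q P X).

Let X_rc w t : 0 <= t -> \forall s \near t^'+, X s w = X t w.
Proof. exact: (chain_right_continuous hX). Qed.

(** Unlike [jump_chain], this does not identify an infinite jump time with the cemetery state. *)
Definition jump_state m v : set T :=
  [set w | exists2 r, jump_time (X^~ w) m = r%:E & X r w = v].

Let bigcup_countType (I : countType) (F : I -> set T) :
  (forall i, measurable (F i)) -> measurable (\bigcup_i F i).
Proof. by apply: countable_bigcupT_measurable; exact: countableP. Qed.

Let measurable_neq t v : 0 <= t -> measurable (~` [set w | X t w = v]).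
Proof. by move=> t0; apply: measurableC; exact: (chain_measurable hX). Qed.

Lemma measurable_jump_state m v :
  (forall t, measurable [set w | (jump_time (X^~ w) m < t%:E)%E]) ->
  measurable (jump_state m v).
Proof.
move=> mJ; pose A (q : rat) := [set w | (jump_time (X^~ w) m < (ratr q)%:E)%E].
(* [B q q'] collects the violations at [q'] of the condition attached to [q]. Since jump times are
   nonnegative, violations occur only at nonnegative [q'], where the state is known to be
   measurable. *)
pose B (q q' : rat) := if (q' <= q) && (0 <= q')
  then A q' `&` ~` [set w | X (ratr q') w = v] else set0.
have -> : jump_state m v = \bigcup_q (A q `\` \bigcup_q' B q q').
  apply/seteqP; split=> w.
    move=> /(jump_state_rat (@X_rc w)) [q Jq Hq]; exists q => //; split=> //.
    by move=> [q' _]; rewrite /B; case: ifP => // /andP[qq _] [/Hq-/(_ qq)].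
  move=> [q _ [Jq Hq]]; apply/(jump_state_rat (@X_rc w)); exists q => // q' qq Jq'.
  apply: contrapT => Xq'; apply: Hq; exists q' => //; rewrite /B qq.
  have [r Jr r0] := jump_time_fin Jq'.
  suff -> : 0 <= q' by split.
  rewrite -(ler0q R) (le_trans r0)// -lee_fin -Jr; exact: ltW.
apply: bigcup_countType => q; apply: measurableD; first exact: mJ.
apply: bigcup_countType => q'; rewrite /B; case: ifP => // /andP[_ q0].
by apply: measurableI; [exact: mJ|apply: measurable_neq; rewrite ler0q].
Qed.

(** By induction on [m]: measurability of one jump time gives that of the state entered, and the two
    give the next jump time as a countable union over rational times and states. *)
Lemma measurable_jump_time_lt m t :
  measurable [set w | (jump_time (X^~ w) m < t%:E)%E].
Proof.
elim: m t => [|m IH] t.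
  have [t0|t0] := boolP (0 < t).
    by rewrite (_ : [set w | _] = setT)//; apply/seteqP; split=> w //= _;
      rewrite lte_fin.
  by rewrite (_ : [set w | _] = set0)//; apply/seteqP; split=> w //=;
    rewrite lte_fin (negbTE t0).
pose F (q : rat) (v : option nat) := if (0 <= q) && (ratr q < t)
  then [set w | (jump_time (X^~ w) m < (ratr q)%:E)%E] `&` jump_state m v
         `&` ~` [set w | X (ratr q) w = v] else set0.
rewrite (_ : [set w | _] = \bigcup_q \bigcup_v F q v); last first.
  apply/seteqP; split=> w.
    move=> /(jump_timeS_lt (@X_rc w)) [q [v [qt Jq Cv Xq]]].
    exists q => //; exists v => //; rewrite /F qt andbT.
    have [r Jr r0] := jump_time_fin Jq.
    suff -> : 0 <= q by split.
    by rewrite -(ler0q R) (le_trans r0)// -lee_fin -Jr; exact: ltW.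
  move=> [q _ [v _]]; rewrite /F; case: ifP => // /andP[q0 qt] [[Jq Cv] Xq].
  by apply/(jump_timeS_lt (@X_rc w)); exists q, v.
apply: bigcup_countType => q; apply: bigcup_countType => v; rewrite /F.
case: ifP => // /andP[q0 _]; apply: measurableI.
  by apply: measurableI; [exact: IH|exact: measurable_jump_state].
by apply: measurable_neq; rewrite ler0q.
Qed.

Lemma measurable_jump_chain m j :
  measurable [set w | jump_chain (X^~ w) m = Some j].
Proof.
rewrite (_ : [set w | _] = jump_state m (Some j)).
  exact/measurable_jump_state/measurable_jump_time_lt.
apply/seteqP; split=> w; rewrite /jump_state /jump_chain/=.
  by case Jm : (jump_time (X^~ w) m) => [r| |]// Xr; exists r.
by move=> [r -> Xr].
Qed.

Lemma measurable_jump_chain_event m i : measurable (jump_chain_event X m i).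
Proof.
rewrite (_ : jump_chain_event X m i = \bigcap_(k in [set k | (k <= m)%N])
  [set w | jump_chain (X^~ w) k = Some (i k)])//.
by apply: bigcap_measurableType => k _; exact: measurable_jump_chain.
Qed.

(** * Visits to 0 within finitely many jumps, and their probabilities *)

Definition hits0 m l : set T :=
  [set w | exists k, [/\ (m < k)%N, (k <= m + l)%N &
                         jump_chain (X^~ w) k = Some 0%N]].

Lemma measurable_hits0 m l : measurable (hits0 m l).
Proof.
rewrite (_ : hits0 m l = \bigcup_(k in [set k | (m < k <= m + l)%N])
  [set w | jump_chain (X^~ w) k = Some 0%N]).
  by apply: bigcup_measurable => k _; exact: measurable_jump_chain.
by apply/seteqP; split=> w [k]; [case=> mk kl h|move=> /andP[mk kl] h];
  exists k => //=; rewrite mk.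
Qed.

(** The sets [B j] need not cover [C], but their measures exhaust that of [C], so what they miss is
    null. The jump law controls transitions only in this almost sure sense. *)
Lemma probability_partition (mu : probability T R) N (A C : set T) (B : nat -> set T) :
  measurable A -> measurable C -> (forall j, measurable (B j)) ->
  trivIset `I_N B -> (forall j, B j `<=` C) -> A `<=` C ->
  mu C = (\sum_(j < N) mu (B j))%E ->
  mu A = (\sum_(j < N) mu (A `&` B j))%E.
Proof.
move=> mA mC mB tB BC AC muC.
pose U := \bigcup_(j in `I_N) B j.
have mU : measurable U by apply: bigcup_measurable.
have sumU (F : nat -> set T) : (forall j, measurable (F j)) -> trivIset `I_N F ->
    mu (\bigcup_(j in `I_N) F j) = (\sum_(j < N) mu (F j))%E.
  move=> mF tF; rewrite bigcup_mkord measure_semi_additive_ord_I//.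
  by apply: bigsetU_measurable.
have UC : U `<=` C by move=> w [j _ /BC].
have CU0 : mu (C `\` U) = 0%E.
  have -> : mu (C `\` U) = (mu C - mu U)%E.
    rewrite measureD// ?(le_lt_trans (probability_le1 _ _)) ?ltry//.
    by rewrite (setIidr UC).
  have -> : mu U = mu C by rewrite muC; exact: sumU.
  by rewrite subee// fin_num_measure.
transitivity (mu (A `&` U)); last first.
  rewrite /U setI_bigcupr; apply: sumU => [j|j k jN kN]; first exact: measurableI.
  by move=> [w [[_ Bj] [_ Bk]]]; apply: tB => //; exists w.
have -> : mu A = (mu (A `\` U) + mu (A `&` U))%E by exact: measureDI.
rewrite (_ : mu (A `\` U) = 0%E) ?add0e//; apply/eqP.
rewrite -measure_le0 -CU0 le_measure ?inE//; [exact: measurableD|exact: measurableD|].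
by apply: setSD.
Qed.

Context (hQ : single_birth Q).

Definition extend_path (i : nat -> nat) m j k := if (k <= m)%N then i k else j.

Lemma extend_path_eq i m j : extend_path i m j m.+1 = j.
Proof. by rewrite /extend_path ltnn. Qed.

Lemma extend_path_le i m j k : (k <= m)%N -> extend_path i m j k = i k.
Proof. by rewrite /extend_path => ->. Qed.

Lemma prob_extend_path n m i c j : P n (jump_chain_event X m i) = c%:E ->
  P n (jump_chain_event X m.+1 (extend_path i m j)) =
  (c * jump_matrix Q (i m) j)%:E.
Proof.
rewrite !(chain_jump_law hX) => -[<-]; congr (_%:E).
rewrite big_ord_recr /= mulrA extend_path_eq !extend_path_le//.
congr (_ * _ * _); apply: eq_bigr => k _.
by rewrite !extend_path_le// ltnW.
Qed.

Lemma extend_path_sub i m j :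
  jump_chain_event X m.+1 (extend_path i m j) `<=` jump_chain_event X m i.
Proof. by move=> w h k km; rewrite h ?leqW// extend_path_le. Qed.

(* First-step analysis: both sides are split over the state entered at jump m + 1. *)
Lemma prob_hits0_event n m i c l : P n (jump_chain_event X m i) = c%:E ->
  P n (jump_chain_event X m i `&` hits0 m l) =
  (c * iter l (return_step Q) (fun=> 0) (i m))%:E.
Proof.
elim: l m i c => [|l IH] m i c Pc.
  rewrite /= mulr0 (_ : _ `&` _ = set0) ?measure0//.
  apply/seteqP; split=> w // [_ [k [mk + _]]].
  by rewrite addn0 leqNgt mk.
pose B j := jump_chain_event X m.+1 (extend_path i m j).
(* From [i m] a jump reaches at most [(i m).+1], hence [(i m).+2] candidate states. *)
rewrite (@probability_partition (P n) (i m).+2 _ (jump_chain_event X m i) B).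
- rewrite iterS /return_step mulr_sumr -sumEFin; apply: eq_bigr => j _.
  have PB := prob_extend_path j Pc.
  (* Entering 0 is already a visit, whence the factor 1; from any other state the visit must come at
     one of the [l] following jumps, and induction applies to the extended path. *)
  rewrite mulrA /set1_at0; have [j0|j0] := eqVneq (j : nat) 0%N.
    rewrite mulr1 -PB -/(B j); congr (P n _); apply/setIidr => w wB; split.
      exact: extend_path_sub wB.
    by exists m.+1; rewrite wB// extend_path_eq j0 addnS ltnS leq_addr.
  rewrite -(extend_path_eq i m j) -IH ?extend_path_eq//; congr (P n _).
  apply/seteqP; split=> w.
    move=> [[_ [k [mk kl h]]] wB]; split=> //; exists k.
    split=> //; last by rewrite addSnnS.
    rewrite ltn_neqAle mk andbT; apply/eqP => mk'; move: h; rewrite -mk' wB//.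
    by rewrite extend_path_eq => -[] /eqP; rewrite (negbTE j0).
  move=> [wB [k [mk kl h]]]; split=> //; split; first exact: extend_path_sub wB.
  by exists k; split=> //; [exact: ltnW|rewrite addnS -addSn].
- apply: measurableI; [exact: measurable_jump_chain_event|exact: measurable_hits0].
- exact: measurable_jump_chain_event.
- by move=> j; exact: measurable_jump_chain_event.
- move=> j k _ _ [w [wj wk]]; have := wj m.+1 (leqnn _).
  by rewrite wk// !extend_path_eq => -[].
- by move=> j; exact: extend_path_sub.
- exact: subIsetl.
- rewrite Pc; under eq_bigr do rewrite (prob_extend_path _ Pc).
  by rewrite sumEFin -mulr_sumr jump_matrix_row_sum// mulr1.
Qed.

Lemma prob_hits0 n l :
  P n (hits0 0 l) = (iter l (return_step Q) (fun=> 0) n)%:E.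
Proof.
have P1 : P n (jump_chain_event X 0 (fun=> n)) = 1%:E.
  by rewrite (chain_jump_law hX) eqxx big_ord0 mulr1.
rewrite -[X in X%:E]mul1r -(prob_hits0_event l P1).
have mE := measurable_jump_chain_event 0 (fun=> n).
have mH := measurable_hits0 0 l.
have -> : P n (hits0 0 l) = (P n (hits0 0 l `\` jump_chain_event X 0 (fun=> n)) +
    P n (jump_chain_event X 0 (fun=> n) `&` hits0 0 l))%E.
  by rewrite setIC; exact: measureDI.
(* The chain starts at [n] almost surely, so the part outside that event is null. *)
rewrite (_ : P n (_ `\` _) = 0%E) ?add0e//; apply/eqP.
rewrite -measure_le0.
have <- : P n (~` jump_chain_event X 0 (fun=> n)) = 0%E.
  by rewrite probability_setC// P1 subee.
apply: le_measure; rewrite ?inE//.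
- exact: measurableD.
- exact: measurableC.
Qed.

(** * Return probabilities as the least solution of the first-step equations *)

Lemma return_event_hits0 :
  [set w | (sigma0 (X^~ w) < +oo)%E] = \bigcup_l hits0 0 l.
Proof.
apply/seteqP; split=> w.
  move=> /(sigma0_fin (chain_minimal hX (w := w)))[m m0 h].
  by exists m => //; exists m.
move=> [l _ [k [k0 _ h]]].
by apply/(sigma0_fin (chain_minimal hX (w := w))); exists k.
Qed.

Lemma measurable_return_event :
  measurable [set w | (sigma0 (X^~ w) < +oo)%E].
Proof.
by rewrite return_event_hits0; apply: bigcup_measurable => l _; exact: measurable_hits0.
Qed.

Lemma return_prob_fin n : return_prob P X n = (fine (return_prob P X n))%:E.
Proof. by rewrite fineK// fin_num_measure//; exact: measurable_return_event. Qed.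

(** Continuity from below of the measure along the increasing events [hits0 0 l]. *)
Lemma cvg_return_step_iter n :
  (fun l => iter l (return_step Q) (fun=> 0) n) @ \oo --> fine (return_prob P X n).
Proof.
have : (P n \o hits0 0) @ \oo --> (fine (return_prob P X n))%:E.
  rewrite -return_prob_fin /return_prob return_event_hits0.
  apply: nondecreasing_cvg_mu.
  - by move=> l; exact: measurable_hits0.
  - by rewrite -return_event_hits0; exact: measurable_return_event.
  - move=> l l' ll'; apply/subsetPset => w [k [k0 kl h]]; exists k.
    by split=> //; exact: leq_trans kl _.
move=> /fine_cvgP[_]; apply: cvg_trans; apply: near_eq_cvg.
by apply: nearW => l /=; rewrite prob_hits0.
Qed.

Lemma return_prob01 n : 0 <= fine (return_prob P X n) <= 1.
Proof.
by rewrite -!lee_fin -return_prob_fin measure_ge0 probability_le1//;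
  exact: measurable_return_event.
Qed.

(** Each first-step average is a finite sum, so the limit passes through it; the shifted iterates
    have the same limit. *)
Lemma return_prob_step n :
  return_step Q (fun j => fine (return_prob P X j)) n = fine (return_prob P X n).
Proof.
have := @cvg_return_step_iter n; rewrite -cvg_shiftS.
apply: cvg_unique; first exact: norm_hausdorff.
rewrite /= /return_step; apply: cvg_big; first exact: add_continuous.
move=> j _; apply: cvgM; first exact: cvg_cst.
rewrite /set1_at0.
by case: eqP => _; [exact: cvg_cst|exact: cvg_return_step_iter].
Qed.

(** The step is monotone, so the iterates started at 0 stay below any nonnegative fixed point, and
    so does their limit. *)
Lemma return_prob_minimal (g : nat -> R) : (forall n, 0 <= g n) ->
  (forall n, return_step Q g n = g n) ->
  forall n, fine (return_prob P X n) <= g n.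
Proof.
move=> g0 gstep n; apply: (cvgr_to_le (@cvg_return_step_iter n)).
apply: nearW => l; elim: l n => [|l IH] n //=; rewrite -gstep.
apply: ler_sum => j _; apply: ler_wpM2l; first exact: jump_matrix_ge0.
by rewrite /set1_at0; case: eqP.
Qed.

Lemma return_probE n : return_prob P X n = (Fratio Q (maxn 1 n))%:E.
Proof.
rewrite return_prob_fin; congr (_%:E).
exact: (Fratio_minimal hQ return_prob01 return_prob_step return_prob_minimal).
Qed.
End JumpChain.

Theorem proposition4p2 (R : realType) (Q : nat -> nat -> R)
    (d : measure_display) (T : measurableType d)
    (P : nat -> probability T R) (X : R -> T -> option nat)
    (hQ : single_birth Q)
    (hX : markov_chain Q P X)
    (hne : nonexplosive P X) :
  [/\ return_prob P X 0 = (Fratio Q 1)%:E,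
      (forall n : nat, (1 <= n)%N -> return_prob P X n = (Fratio Q n)%:E),
      ((forall n : nat, return_prob P X n = 1%:E) <-> return_prob P X 0 = 1%:E)
    & (return_prob P X 0 = 1%:E <-> Ftail Q 0 = +oo%E)].
Proof.
have H0 : return_prob P X 0 = 1%:E <-> Ftail Q 0 = +oo%E.
  by rewrite (return_probE hX hQ) -(Fratio1_eq1 hQ); split=> [[]|->].
split=> //.
- by rewrite (return_probE hX hQ).
- by move=> n n1; rewrite (return_probE hX hQ) (maxn_idPr n1).
(* Certain return to 0 from 0 forces divergence, under which every ratio is 1 by convention. *)
- split=> [//|/H0 Fy n].
  by rewrite (return_probE hX hQ) /Fratio Fy eqxx.
Qed.
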